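(* Let $G$ be a finite simple graph of order $n$, size $m$, and minimum degree $\delta(G)\geq 3$, and let $k\geq 2$ be an integer. Then $$\gamma_{st}(G^{\frac{1}{k}})=\begin{cases} n & \text{if } k=2,3,\\ n+m\left\lceil \frac{k-3}{3}\right\rceil & \text{otherwise.}\end{cases}$$
   Context: For a finite simple graph $G$, a set $D\subseteq V(G)$ is a strong dominating set of $G$ if for every vertex $x\in V(G)\setminus D$ there is a vertex $y\in D$ with $xy\in E(G)$ and $\deg(x)\leq\deg(y)$ (degrees taken in $G$). The strong domination number $\gamma_{st}(G)$ is the minimum cardinality of a strong dominating set of $G$. The order and size of $G$ are its numbers of vertices and edges. The $k$-subdivision $G^{\frac{1}{k}}$ of $G$ is obtained by replacing each edge $v_iv_j$ of $G$ with a path of length $k$ between $v_i$ and $v_j$ (with $k-1$ new internal vertices, distinct for different edges); thus it has $n+(k-1)m$ vertices and $km$ edges. *)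

(* Defs.v *)
From mathcomp Require Import all_boot all_order all_algebra.

Set Implicit Arguments.
Unset Strict Implicit.
Unset Printing Implicit Defensive.

Record sgraph := SGraph {
  svertex :> finType;
  sedge : rel svertex;
  sedge_sym : symmetric sedge;
  sedge_irr : irreflexive sedge
}.

Notation "x -- y" := (sedge x y) (at level 30).

Section GraphInvariants.
Variable G : sgraph.

Definition graph_order : nat := #|G|.

Definition edges : {set {set G}} :=
  [set [set p.1; p.2] | p in [pred p : G * G | p.1 -- p.2]].

Definition graph_size : nat := #|edges|.

Definition degree (x : G) : nat := #|[set y | x -- y]|.

(* Degrees are smaller than #|G|, so the default value only matters for the
   graph without vertices, whose minimum degree is 0 by convention. *)
Definition min_degree : nat := \big[minn/#|G|]_(x : G) degree x.

Definition strong_dominating (D : {set G}) : bool :=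
  [forall (x | x \notin D),
     exists y in D, (x -- y) && (degree x <= degree y)].

Definition strong_domination_number : nat :=
  #|[arg min_(D < [set: G] | strong_dominating D) #|D|]|.

End GraphInvariants.

Lemma strong_dominatingT (G : sgraph) : strong_dominating [set: G].
Proof. by apply/forall_inP => x; rewrite inE. Qed.

Lemma strong_domination_numberP (G : sgraph) :
  (exists2 D : {set G},
     strong_dominating D & #|D| = strong_domination_number G) /\
  (forall D : {set G},
     strong_dominating D -> strong_domination_number G <= #|D|).
Proof.
rewrite /strong_domination_number.
by case: arg_minnP => [|D sD minD]; [exact: strong_dominatingT | split; first exists D].
Qed.

Section Subdivision.
Variables (k : nat) (G : sgraph).

Definition edge_type : finType := {E : {set G} | E \in edges G}.

Lemma edge_endsP (E : edge_type) :
  exists p : G * G, (p.1 -- p.2) && (val E == [set p.1; p.2]).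
Proof. by case: E => E /= /imsetP[p pE ->]; exists p; rewrite eqxx andbT. Qed.

(* The endpoints of an edge, in an arbitrary but fixed order. *)
Definition edge_ends (E : edge_type) : G * G := xchoose (edge_endsP E).

(* inr (E, i) is the internal vertex at distance i.+1 from (edge_ends E).1 on
   the path that replaces the edge E. *)
Definition subdiv_vertex : finType := (G + edge_type * 'I_k.-1)%type.

(* The j-th vertex, 0 <= j <= k, of the path that replaces the edge E. *)
Definition subdiv_path (E : edge_type) (j : nat) : subdiv_vertex :=
  if j is i.+1 then
    if insub i is Some i' then inr (E, i') else inl (edge_ends E).2
  else inl (edge_ends E).1.

Definition subdiv_rel : rel subdiv_vertex := fun a b =>
  [exists E : edge_type, exists j : 'I_k,
     [set a; b] == [set subdiv_path E j; subdiv_path E j.+1]].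

Lemma subdiv_rel_sym : symmetric subdiv_rel.
Proof. by move=> a b; rewrite /subdiv_rel setUC. Qed.

Lemma subdiv_path_neq (E : edge_type) (j : nat) :
  j < k -> subdiv_path E j != subdiv_path E j.+1.
Proof.
have /andP[uv _] := xchooseP (edge_endsP E).
have uv' : (edge_ends E).1 != (edge_ends E).2.
  by apply: contraTneq uv; rewrite -/(edge_ends E) => ->; rewrite sedge_irr.
case: j => [|j] jk /=; first by case: insubP.
rewrite insubT => [|jk']; first by rewrite -ltnS (ltn_predK jk).
case: insubP => //= i _ ij; apply/eqP => -[] /(congr1 val) /=.
by rewrite ij => /n_Sn.
Qed.

Lemma subdiv_rel_irr : irreflexive subdiv_rel.
Proof.
move=> a; apply/negbTE/existsPn => E; apply/existsPn => j.
have := subdiv_path_neq E (ltn_ord j); apply: contraNneq; rewrite setUid => /setP eqa.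
have:= eqa (subdiv_path E j.+1); have := eqa (subdiv_path E j).
by rewrite !inE !eqxx orbT => /eqP -> /eqP ->.
Qed.

Definition subdivision : sgraph := SGraph subdiv_rel_sym subdiv_rel_irr.

Lemma order_subdivision : graph_order subdivision = graph_order G + k.-1 * graph_size G.
Proof. by rewrite /graph_order card_sum card_prod card_sig card_ord mulnC. Qed.

End Subdivision.

(* Main.v *)
Require Import Defs.
From mathcomp Require Import all_boot all_order all_algebra.
From mathcomp Require Import zify lra.

(** The value is [n + m * ((k - 1) %/ 3)] for every [k >= 2]; the ceiling
    [ceil ((k - 3) / 3)] is this quotient, which vanishes for [k = 2, 3].

    Subdividing keeps the degree of an old vertex at least 3 and creates only
    vertices of degree 2.  For [k >= 2] all neighbours of an old vertex are
    internal, hence of smaller degree, so every strong dominating set contains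
    all old vertices.  Along a subdivided edge, cut the internal vertices
    (positions [1 .. k - 1]) into [(k - 1) %/ 3] consecutive triples and a
    remainder of at most two vertices.  The middle vertex of a triple has its
    closed neighbourhood inside the triple, so each triple meets every strong
    dominating set: this is the lower bound
    ([strong_domination_subdivision_ge]).  Conversely the old vertices and the
    internal vertices at positions divisible by 3, i.e. the last ones of the
    triples, form a strong dominating set: a position that is 1 modulo 3 has
    its predecessor in the set and one that is 2 modulo 3 its successor, the
    end points 0 and [k] of the path being in the set
    ([triple_ends_strong_dominating]).

    Both bounds compare the set with the type [subdivision_part] of old vertices
    and triples. *)

Import Num.Theory.

Set Implicit Arguments.
Unset Strict Implicit.
Unset Printing Implicit Defensive.

Lemma min_degree_le (G : sgraph) (x : G) : min_degree G <= degree x.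
Proof.
rewrite /min_degree; have := mem_index_enum x.
elim: (index_enum G) => //= y r IH; rewrite inE big_cons geq_min.
by case/orP => [/eqP ->|/IH ->]; rewrite ?leqnn ?orbT.
Qed.

Lemma edge_ends_adj (G : sgraph) (E : edge_type G) :
  (edge_ends E).1 -- (edge_ends E).2.
Proof. by have /andP[] := xchooseP (edge_endsP E). Qed.

Lemma edge_endsE (G : sgraph) (E : edge_type G) :
  val E = [set (edge_ends E).1; (edge_ends E).2].
Proof. by have /andP[_ /eqP] := xchooseP (edge_endsP E). Qed.

Lemma edge_ends_neq (G : sgraph) (E : edge_type G) :
  (edge_ends E).1 != (edge_ends E).2.
Proof.
by apply: contraTneq (edge_ends_adj E) => ->; rewrite sedge_irr.
Qed.

Lemma set2_eqr (T : finType) (a u v : T) :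
  u != v -> [set a; v] = [set u; v] -> a = u.
Proof.
move=> uv /setP /(_ u); rewrite !inE eqxx (negbTE uv) orbF.
by move=> /eqP ->.
Qed.

(** * Adjacency and degrees in a subdivision *)

Section Subdivision.
Variables (k : nat) (G : sgraph).
Hypothesis k_ge2 : 2 <= k.
Implicit Types (E : edge_type G) (i : 'I_k.-1).

Local Notation H := (subdivision k G).
Local Notation path_vertex := (@subdiv_path k G).

Lemma subdiv_path_internal E i : path_vertex E i.+1 = inr (E, i).
Proof. by rewrite /= valK. Qed.

Lemma subdiv_path_last E : path_vertex E k = inl (edge_ends E).2.
Proof. by case: k k_ge2 => //= k' _; rewrite insubF ?ltnn. Qed.

Lemma subdiv_path_inr E E' i j :
  path_vertex E' j = inr (E, i) -> E' = E /\ j = i.+1.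
Proof.
by case: j => //= j; case: insubP => // i' _ <- [-> ->].
Qed.

Lemma subdiv_path_inl E j v :
  j < k -> path_vertex E j = inl v -> j = 0.
Proof.
case: j => //= j jk; rewrite insubT //; lia.
Qed.

(** Besides the injectivity of the path this uses that an edge has distinct
    ends: for [k = 2] the two vertices are these ends. *)
Lemma subdiv_path_neq2 E i : path_vertex E i != path_vertex E i.+2.
Proof.
have lt_ik := ltn_ord i.
case Ei: (path_vertex E i) => [v|[E' i']].
  have i0 : i = 0 :> nat by apply: subdiv_path_inl Ei; lia.
  move: Ei; rewrite i0 => -[<-].
  have [<-|k_neq2] := eqVneq k 2.
    by rewrite subdiv_path_last; apply: contra (edge_ends_neq E) => /eqP[->].
  by apply/eqP => /esym /subdiv_path_inl; lia.
have [-> def_i] := subdiv_path_inr Ei.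
by apply/eqP => /esym /subdiv_path_inr[_]; lia.
Qed.

(** An internal vertex determines its edge and its position on the path, so
    the only path segments through it are the two around that position. *)
Lemma subdiv_adj_internal (a : H) E i :
  a -- (inr (E, i) : H) =
  (a == path_vertex E i) || (a == path_vertex E i.+2).
Proof.
have lt_ik := ltn_ord i.
apply/idP/idP => [/existsP[E' /existsP[j /eqP eq_set]] | ].
  have neq := subdiv_path_neq E' (ltn_ord j).
  have : inr (E, i) \in [set path_vertex E' j; path_vertex E' j.+1].
    by rewrite -eq_set !inE eqxx orbT.
  rewrite !inE => /orP[] /eqP /esym eq_i; have [eqE eq_j] := subdiv_path_inr eq_i.
    move: eq_set neq; rewrite eq_i setUC [RHS]setUC setUC => eq_set neq.
    rewrite eq_sym in neq; apply/orP; right; apply/eqP.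
    by rewrite -eqE -eq_j; apply: set2_eqr neq _; rewrite eq_set setUC.
  move: eq_set neq; rewrite eq_i => eq_set neq.
  apply/orP; left; apply/eqP; rewrite (set2_eqr neq eq_set) eqE.
  by case: eq_j => ->.
case/orP => /eqP ->; apply/existsP; exists E; apply/existsP.
  have lt_i : i < k by lia.
  by exists (Ordinal lt_i); rewrite subdiv_path_internal.
have lt_i : i.+1 < k by lia.
by exists (Ordinal lt_i); rewrite subdiv_path_internal setUC.
Qed.

(** Only the end points of a path are old, and they are at distance
    [k >= 2]. *)
Lemma subdiv_adj_old (v w : G) : (inl v : H) -- (inl w : H) = false.
Proof.
apply/negbTE/existsPn => E; apply/existsPn => j; apply/eqP => eq_set.
have old (u : H) : u \in [set path_vertex E j; path_vertex E j.+1] ->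
    exists x, u = inl x.
  by rewrite -eq_set !inE => /orP[] /eqP ->; eexists.
have [x /(subdiv_path_inl (ltn_ord j)) j0] := old _ (set21 _ _).
have [y] := old _ (set22 _ _).
by rewrite j0 => /(subdiv_path_inl k_ge2).
Qed.

Lemma degree_internal E i : degree (inr (E, i) : H) = 2.
Proof.
suff -> : degree (inr (E, i) : H) =
    #|[set path_vertex E i; path_vertex E i.+2]|.
  by rewrite cards2 subdiv_path_neq2.
congr #|pred_of_set _|; apply/setP => a.
by rewrite !inE sedge_sym subdiv_adj_internal.
Qed.

(** Each edge at [v] contributes the internal vertex next to [v] on its path,
    which is the first or the last one according to the orientation of the
    edge. *)
Lemma degree_old (v : G) : degree v <= degree (inl v : H).
Proof.
have first_lt : 0 < k.-1 by lia.
have last_lt : k.-2 < k.-1 by lia.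
pose next E : H :=
  inr (E, if (edge_ends E).1 == v then Ordinal first_lt else Ordinal last_lt).
have next_adj E : v \in val E -> (inl v : H) -- next E.
  rewrite edge_endsE !inE subdiv_adj_internal !(eq_sym v).
  case: ifP => [/eqP <- _ | _ /eqP ev]; first by rewrite eqxx.
  have -> : (Ordinal last_lt).+2 = k by rewrite /=; lia.
  by rewrite subdiv_path_last ev eqxx orbT.
pose star := [set E : edge_type G | v \in val E].
have le_star : #|star| <= degree (inl v : H).
  rewrite /degree -(card_imset (mem star) (f := next)); last by move=> E E' [].
  apply/subset_leq_card/subsetP => _ /imsetP[E vE ->].
  by rewrite inE in vE; rewrite inE next_adj.
apply: leq_trans le_star; rewrite -(card_imset (mem star) val_inj) /degree.
rewrite -(card_in_imset (f := fun y : G => [set v; y])); last first.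
  move=> y y' _ _ /=; rewrite ![[set v; _]]setUC => eq_set.
  have [yv|] := eqVneq y' v; last by move/set2_eqr; apply.
  by have := set21 y v; rewrite eq_set yv !inE orbb => /eqP.
apply/subset_leq_card/subsetP => _ /imsetP[y vy ->].
have vyE : [set v; y] \in edges G.
  by rewrite inE in vy; apply/imsetP; exists (v, y).
by apply/imsetP; exists (Sub [set v; y] vyE); rewrite // inE /= set21.
Qed.

(** * Lower bound *)

(** All neighbours of [v] are internal, and their degree 2 is too small for
    them to dominate [v]. *)
Lemma old_in_strong_dominating (D : {set H}) (v : G) :
  3 <= degree v -> strong_dominating D -> (inl v : H) \in D.
Proof.
move=> deg3 sD; apply/negPn/negP => vD.
have /exists_inP[[w | [E i]] _ /andP[adj]] := forall_inP sD _ vD.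
  by rewrite subdiv_adj_old in adj.
by rewrite degree_internal leqNgt (leq_trans deg3 (degree_old v)).
Qed.

Local Notation q := (k.-1 %/ 3).

Definition subdivision_part : finType := (G + edge_type G * 'I_q)%type.

Lemma card_subdivision_part : #|subdivision_part| = #|G| + graph_size G * q.
Proof. by rewrite card_sum card_prod card_sig card_ord. Qed.

(** The middle vertex of a triple is dominated, or contained in [D], from
    inside the triple. *)
Lemma triple_meets_strong_dominating (D : {set H}) E (t : 'I_q) :
  strong_dominating D -> exists2 i, inr (E, i) \in D & i %/ 3 = t.
Proof.
move=> sD; have lt_tq := ltn_ord t.
(* [j.+1] is the position of the internal vertex with index [j]. *)
have in_triple j : j < k.-1 -> path_vertex E j.+1 \in D -> j %/ 3 = t ->
    exists2 i, inr (E, i) \in D & i %/ 3 = t.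
  by move=> lt_j jD j_t; exists (Ordinal lt_j); rewrite // -subdiv_path_internal.
have mid_lt : (3 * t).+1 < k.-1 by lia.
have [midD | midD] := boolP ((inr (E, Ordinal mid_lt) : H) \in D).
  by exists (Ordinal mid_lt) => //=; lia.
have /exists_inP[y yD /andP[adj _]] := forall_inP sD _ midD.
move: adj yD; rewrite sedge_sym subdiv_adj_internal => /orP[] /eqP -> yD.
  by apply: (in_triple (3 * t)) => //; lia.
by apply: (in_triple (3 * t).+2) => //; lia.
Qed.

(** Sending an old vertex to itself and an internal vertex to
    its triple maps [D] onto all old vertices and triples.  The map is partial
    because the last internal vertices may belong to no triple. *)
Lemma strong_domination_subdivision_ge (D : {set H}) :
  (forall v : G, 3 <= degree v) -> strong_dominating D ->
  #|G| + graph_size G * q <= #|D|.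
Proof.
move=> deg3 sD.
pose part (x : H) : option subdivision_part :=
  match x with
  | inl v => Some (inl v)
  | inr (E, i) =>
      if insub (i %/ 3 : nat) is Some t then Some (inr (E, t)) else None
  end.
rewrite -card_subdivision_part -cardsT -(card_imset _ (@Some_inj _)).
apply: leq_trans (leq_imset_card part (mem D)).
apply/subset_leq_card/subsetP => _ /imsetP[s _ ->]; apply/imsetP.
case: s => [v | [E t]].
  by exists (inl v) => //; apply: old_in_strong_dominating.
have [i iD i_t] := triple_meets_strong_dominating E t sD.
by exists (inr (E, i)) => //=; rewrite i_t valK.
Qed.

(** * Upper bound *)

Definition triple_ends : {set H} :=
  [set x : H | if x is inr (_, i) then 3 %| i.+1 else true].

Lemma card_triple_ends : #|triple_ends| = #|G| + graph_size G * q.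
Proof.
have end_lt (t : 'I_q) : 3 * t + 2 < k.-1 by have := ltn_ord t; lia.
pose part_end (s : subdivision_part) : H :=
  match s with
  | inl v => inl v
  | inr (E, t) => inr (E, Ordinal (end_lt t))
  end.
have part_end_inj : injective part_end.
  move=> [v | [E t]] [w | [F u]] //= [] => [-> // | -> eq_tu].
  by have -> : t = u by apply: val_inj => /=; lia.
rewrite -card_subdivision_part -cardsT -(card_imset _ part_end_inj).
apply: eq_card => x.
rewrite inE; apply/idP/imsetP => [|[[v | [E t]] _ ->] //=]; last by lia.
case: x => [v _ | [E i] i3]; first by exists (inl v).
have lt_ik := ltn_ord i.
have lt : i %/ 3 < q by lia.
have def_i : i = Ordinal (end_lt (Ordinal lt)) by apply: val_inj => /=; lia.
by exists (inr (E, Ordinal lt)); rewrite // [in LHS]def_i.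
Qed.

Lemma mem_triple_ends_path E j : 3 %| j -> path_vertex E j \in triple_ends.
Proof.
rewrite inE; case: j => //= j j3.
by case: insubP => //= i _ ->.
Qed.

Lemma degree_subdivision_ge2 (x : H) :
  (forall v : G, 3 <= degree v) -> 2 <= degree x.
Proof.
move=> deg3; case: x => [v | [E i]]; last by rewrite degree_internal.
exact: ltnW (leq_trans (deg3 v) (degree_old v)).
Qed.

(** The internal vertex with index [i] is at position [i.+1], so its
    neighbours are at positions [i] and [i.+2], one of which is divisible by 3
    as soon as [i.+1] is not. *)
Lemma triple_ends_strong_dominating :
  (forall v : G, 3 <= degree v) -> strong_dominating triple_ends.
Proof.
move=> deg3; apply/forall_inP => -[v | [E i]]; rewrite inE // => i3.
have dominated j : 3 %| j -> (j == i) || (j == i.+2) ->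
    [exists y in triple_ends, ((inr (E, i) : H) -- y)
       && (degree (inr (E, i) : H) <= degree y)].
  move=> j3 j_i; apply/exists_inP; exists (path_vertex E j).
    exact: mem_triple_ends_path.
  rewrite degree_internal degree_subdivision_ge2 // andbT.
  rewrite sedge_sym subdiv_adj_internal.
  by case/orP: j_i => /eqP ->; rewrite eqxx ?orbT.
have [iv | iv] := boolP (3 %| i); first by apply: (dominated i); rewrite ?eqxx.
by apply: (dominated i.+2); [lia | rewrite eqxx orbT].
Qed.

Lemma strong_domination_number_subdivision :
  (forall v : G, 3 <= degree v) ->
  strong_domination_number H = #|G| + graph_size G * q.
Proof.
move=> deg3; have [[D sD cardD] minD] := strong_domination_numberP H.
apply/eqP; rewrite eqn_leq -{2}cardD strong_domination_subdivision_ge // andbT.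
by rewrite -card_triple_ends; apply/minD/triple_ends_strong_dominating.
Qed.

End Subdivision.

(** * The quotient as a ceiling *)

Lemma ceil_sub3_div3 (k : nat) :
  0 < k -> (Num.ceil ((k%:Q - 3) / 3) = (k.-1 %/ 3)%:Z)%R.
Proof.
move=> k_gt0; apply: ceil_def.
have lo : ((k.-1 %/ 3 * 3 + 1)%N%:Q <= k%:Q)%R by rewrite ler_int; lia.
have hi : (k%:Q <= (k.-1 %/ 3 * 3 + 3)%N%:Q)%R by rewrite ler_int; lia.
lra.
Qed.

Theorem theorem3p1 (G : sgraph) (n m k : nat) :
  graph_order G = n -> graph_size G = m -> 3 <= min_degree G -> 2 <= k ->
  ((strong_domination_number (subdivision k G))%:Z =
    if (k == 2%N) || (k == 3%N) then n%:Z
    else n%:Z + m%:Z * Num.ceil ((k%:Q - 3) / 3))%R.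
Proof.
move=> <- <- deg3 k_ge2.
rewrite strong_domination_number_subdivision //; last first.
  by move=> v; apply: leq_trans deg3 (min_degree_le v).
case: ifP => [/orP[] /eqP -> | _]; rewrite ?muln0 ?addn0 //.
by rewrite ceil_sub3_div3 ?(ltnW k_ge2) // -PoszM -PoszD.
Qed.
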